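(* (Tensorization.) Let $m$ be a positive integer and $c_1,\dots,c_m\in(0,\infty)$. For $i=1,2$ let $Q_X^i$ be a probability measure on $\mathcal{X}^i$, let $Q^i_{Y_j|X}$ be a random transformation from $\mathcal{X}^i$ to $\mathcal{Y}_j^i$ for $j=1,\dots,m$, and let $d^i\in\mathbb{R}$. Say that a tuple $(Q_X,(Q_{Y_j|X})_{j=1}^m,d,(c_j)_{j=1}^m)$ satisfies property $(\ast)$ if $$D(P_X\|Q_X)+d\ge\sum_{j=1}^mc_jD(P_{Y_j}\|Q_{Y_j})\qquad\text{for all probability measures }P_X\ll Q_X.$$ If $(Q_X^i,(Q^i_{Y_j|X}),d^i,(c_j))$ satisfies $(\ast)$ for $i=1,2$, then $(Q_X^1\times Q_X^2,(Q^1_{Y_j|X}\times Q^2_{Y_j|X}),d^1+d^2,(c_j))$ satisfies $(\ast)$.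
   Context: All spaces are measurable spaces and random transformations are Markov kernels. In $(\ast)$, $P_{Y_j}$ and $Q_{Y_j}$ are the output distributions of $Q_{Y_j|X}$ under inputs $P_X$ and $Q_X$ respectively. The superscripts $i$ are indices, not powers. $Q^1_{Y_j|X}\times Q^2_{Y_j|X}$ is the product kernel from $\mathcal{X}^1\times\mathcal{X}^2$ to $\mathcal{Y}_j^1\times\mathcal{Y}_j^2$, sending $(x_1,x_2)$ to the product measure $Q^1_{Y_j|X=x_1}\times Q^2_{Y_j|X=x_2}$. $D(P\|Q):=\mathbb{E}_P[\log\frac{\mathrm{d}P}{\mathrm{d}Q}]$ if $P\ll Q$, and $+\infty$ otherwise. *)

(* Defs.v *)
From HB Require Import structures.
From mathcomp Require Import all_boot all_order all_algebra.
From mathcomp Require Import all_classical all_reals all_analysis.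
From mathcomp Require Import measurable_realfun.

Set Implicit Arguments.
Unset Strict Implicit.
Unset Printing Implicit Defensive.

Import Order.TTheory GRing.Theory Num.Theory.
Import numFieldNormedType.Exports.

Local Open Scope classical_set_scope.
Local Open Scope ring_scope.
Local Open Scope charge_scope.
Local Open Scope ereal_scope.

(* D(P||Q) with the natural logarithm. [lne] is the extended logarithm, with
   lne 0 = -oo; the set where dP/dQ vanishes is P-null. The negative part of
   ln (dP/dQ) is always P-integrable, so no oo - oo occurs in the integral. *)
Definition KL d (T : measurableType d) (R : realType)
    (P Q : probability T R) : \bar R :=
  if `[< P `<< Q >]
  then \int[P]_x lne (('d (charge_of_finite_measure P) '/d Q) x)
  else +oo.

Section output.
Context dX dY (X : measurableType dX) (Y : measurableType dY) (R : realType).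
Variables (P : probability X R) (K : R.-pker X ~> Y).

Definition output (A : set Y) : \bar R := \int[P]_x K x A.

Let output0 : output set0 = 0.
Proof. by apply: integral0_eq => x _; rewrite measure0. Qed.

Let output_ge0 A : 0 <= output A.
Proof. exact: integral_ge0. Qed.

Let output_sigma_additive : semi_sigma_additive output.
Proof.
move=> F mF tF mUF; rewrite [X in _ --> X](_ : _ =
  \int[P]_x (\sum_(n <oo) K x (F n))); last first.
  by apply: eq_integral => x _; apply/esym/cvg_lim => //;
     exact/measure_semi_sigma_additive.
apply/cvg_closeP; split.
  by apply: is_cvg_nneseries => n _ _; exact: integral_ge0.
rewrite closeE// integral_nneseries// => n.
exact: measurable_kernel.
Qed.

HB.instance Definition _ := isMeasure.Build _ _ _ output
  output0 output_ge0 output_sigma_additive.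

Let output_setT : output [set: Y] = 1.
Proof.
rewrite /output (eq_integral (cst 1)) => [|x _]; last by rewrite prob_kernel.
by rewrite integral_cst// mul1e; exact: probability_setT.
Qed.

HB.instance Definition _ := Measure_isProbability.Build _ _ _ output output_setT.

End output.

Section pker_at.
Context dX dY (X : measurableType dX) (Y : measurableType dY) (R : realType).
Variables (K : R.-pker X ~> Y) (x : X).

(* The library does not equip [K x] with its probability structure, which the
   product measure [\x] needs. *)
Definition pker_at : set Y -> \bar R := K x.

HB.instance Definition _ := Measure.on pker_at.

Let pker_at_setT : pker_at [set: Y] = 1.
Proof. exact: prob_kernel. Qed.

HB.instance Definition _ :=
  Measure_isProbability.Build _ _ _ pker_at pker_at_setT.

End pker_at.

Section pker_comp.
Context dX dY dZ (X : measurableType dX) (Y : measurableType dY)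
  (Z : measurableType dZ) (R : realType).
Variables (K : R.-pker X ~> Y) (f : {mfun Z >-> X}).

Definition pker_comp (z : Z) : {measure set Y -> \bar R} := K (f z).

Let measurable_pker_comp U : measurable U ->
  measurable_fun [set: Z] (pker_comp ^~ U).
Proof.
by move=> mU; exact: (measurableT_comp (measurable_kernel K _ mU)
  (@measurable_funPT _ _ _ _ f)).
Qed.

HB.instance Definition _ :=
  isKernel.Build _ _ _ _ _ pker_comp measurable_pker_comp.

Let pker_comp_setT z : pker_comp z [set: Y] = 1.
Proof. exact: prob_kernel. Qed.

HB.instance Definition _ :=
  Kernel_isProbability.Build _ _ _ _ _ pker_comp pker_comp_setT.

End pker_comp.

Section pker_prod.
Context dX1 dX2 dY1 dY2 (X1 : measurableType dX1) (X2 : measurableType dX2)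
  (Y1 : measurableType dY1) (Y2 : measurableType dY2) (R : realType).
Variables (K1 : R.-pker X1 ~> Y1) (K2 : R.-pker X2 ~> Y2).

Definition pker_prod (x : X1 * X2) : {measure set (Y1 * Y2) -> \bar R} :=
  pker_at K1 x.1 \x pker_at K2 x.2.

Let measurable_pker_prod U : measurable U ->
  measurable_fun [set: X1 * X2] (pker_prod ^~ U).
Proof.
move=> mU.
pose p1 : {mfun (X1 * X2)%type >-> X1} :=
  HB.pack (fst : X1 * X2 -> X1) (isMeasurableFun.Build _ _ _ _ _ measurable_fst).
have mp2 : measurable_fun [set: (X1 * X2) * Y1]
   ((fun z => z.1.2) : (X1 * X2) * Y1 -> X2).
  exact: (measurableT_comp measurable_snd measurable_fst).
pose p2 : {mfun ((X1 * X2) * Y1)%type >-> X2} :=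
  HB.pack ((fun z => z.1.2) : (X1 * X2) * Y1 -> X2)
    (isMeasurableFun.Build _ _ _ _ _ mp2).
pose V := (fun w : ((X1 * X2) * Y1) * Y2 => (w.1.2, w.2)) @^-1` U.
have mV : measurable V.
  rewrite /V -[X in measurable X]setTI.
  apply: (_ : measurable_fun _ _) => //.
  apply/measurable_fun_pair => /=; last exact: measurable_snd.
  exact: (measurableT_comp measurable_snd measurable_fst).
have mk : measurable_fun [set: (X1 * X2) * Y1]
    (fun z => pker_comp K2 p2 z (xsection V z)).
  by apply: measurable_fun_xsection_finite_kernel; rewrite inE.
have := @measurable_fun_integral_finite_kernel _ _ _ _ _ _
  (pker_comp K1 p1) (fun=> measure_ge0 _ _) mk.
apply: eq_measurable_fun => x _; apply: eq_integral => y _ /=.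
by congr (K2 _ _); apply/seteqP; split => z; rewrite /xsection/= !inE.
Qed.

HB.instance Definition _ :=
  isKernel.Build _ _ _ _ _ pker_prod measurable_pker_prod.

Let pker_prod_setT x : pker_prod x [set: Y1 * Y2] = 1.
Proof. exact: probability_setT. Qed.

HB.instance Definition _ :=
  Kernel_isProbability.Build _ _ _ _ _ pker_prod pker_prod_setT.

End pker_prod.

Definition star dX (X : measurableType dX) (R : realType) (m : nat)
    (dY : 'I_m -> measure_display) (Y : forall j, measurableType (dY j))
    (Q : probability X R) (K : forall j, R.-pker X ~> Y j)
    (d : R) (c : 'I_m -> R) : Prop :=
  forall P : probability X R, P `<< Q ->
    KL P Q + d%:E >=
    \sum_(j < m) (c j)%:E * KL (output P (K j)) (output Q (K j)).

(* Main.v *)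
(** Densities reduce everything to nonnegative integrals: if [P] has density [g]
    with respect to [Q], then [D(P||Q) = E_Q[phi g]] with
    [phi t = t ln t - t + 1 >= 0].

    Write [P = g(x1) h(x1, x2) (Q1 x Q2)], with marginal [P1] and conditional
    laws [P2 x1]. The chain rule gives
    [D(P||Q1 x Q2) = D(P1||Q1) + E_P1[D(P2 x1||Q2)]], and likewise for the
    outputs [D(P_Yj||Q_Yj) = D(P_Y1j||Q_Y1j) + J j], where
    [J j = E_{P_Yj}[ln h'_j]] and [h'_j(y1, .)] is the conditional density of
    the second output given the first. Applying [star] to the first tuple handles
    the first terms. For the second ones, the Donsker-Varadhan inequality bounds
    the integral of [ln h'_j(y1, .)] under the output of [P2 x1] by the
    divergence of that output, for every [y1]; averaging over [y1 ~ K1 x1],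
    using [star] for the second tuple at [P2 x1], and then averaging over
    [x1 ~ P1] yields [sum_j c_j J j <= E_P1[D(P2 x1||Q2)] + d2].

    The Y-spaces need not be countably generated, so [x1 |-> D(output (P2 x1))]
    might not be measurable: only its Donsker-Varadhan minorant is integrated.
    The positive and negative parts of [ln h'_j] are kept on opposite sides of
    the inequalities, the negative one having integral at most 1. *)

Require Import Defs.
From HB Require Import structures.
From mathcomp Require Import all_boot all_order all_algebra.
From mathcomp Require Import all_classical all_reals all_analysis.
From mathcomp Require Import measurable_realfun ring lra.

Set Implicit Arguments.
Unset Strict Implicit.
Unset Printing Implicit Defensive.

Import Order.TTheory GRing.Theory Num.Theory.
Import numFieldNormedType.Exports.

Local Open Scope classical_set_scope.
Local Open Scope ring_scope.
Local Open Scope charge_scope.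
Local Open Scope ereal_scope.

Lemma addeI_fin {R : numDomainType} (z x y : \bar R) : z \is a fin_num ->
  x + z = y + z -> x = y.
Proof. by move=> zf xy; rewrite -(addeK x zf) xy addeK. Qed.

(** * The function t ln t - t + 1 and the positive and negative parts of the logarithm *)

Section kl_fun.
Context {R : realType}.
Implicit Types a b p h t : R.

Definition kl_fun t : R := (t * ln t - t + 1)%R.

(** The two parts of the logarithm are extended-valued in order to follow [lne 0 = -oo]: at 0,
    [logp] is 0 and [logm] is [+oo]. *)
Definition logp t : \bar R := maxe (lne t%:E) 0.

Definition logm t : \bar R := maxe (- lne t%:E) 0.

Lemma logp_ge0 t : 0 <= logp t.
Proof. by rewrite /logp le_max lexx orbT. Qed.

Lemma logm_ge0 t : 0 <= logm t.
Proof. by rewrite /logm le_max lexx orbT. Qed.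

Let logpE t : (0 < t)%R -> logp t = (Num.max (ln t) 0)%:E.
Proof. by move=> t0; rewrite /logp lne_EFin// EFin_max. Qed.

Let logmE t : (0 < t)%R -> logm t = (Num.max (- ln t) 0)%:E.
Proof. by move=> t0; rewrite /logm lne_EFin// EFin_max. Qed.

Let logm0 : logm 0 = +oo.
Proof. by rewrite /logm le0_lneNy//= maxye. Qed.

Let ln_leB1 t : (0 < t)%R -> (ln t <= t - 1)%R.
Proof.
by move=> t0; rewrite -[X in ln X](addrNK 1%R) addrC le_ln1Dx//; lra.
Qed.

Let ln_ge1B t : (0 < t)%R -> (1 - t^-1 <= ln t)%R.
Proof.
move=> t0; have := @ln_leB1 t^-1; rewrite invr_gt0 => /(_ t0).
rewrite lnV ?posrE//; lra.
Qed.

Lemma kl_fun_ge0 t : (0 <= t)%R -> (0 <= kl_fun t)%R.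
Proof.
rewrite /kl_fun le_eqVlt => /predU1P[<-|t0]; first by lra.
have := ler_wpM2l (ltW t0) (ln_ge1B t0).
by rewrite mulrBr mulr1 divff ?gt_eqF//; lra.
Qed.

(** Expanding [ln (a * b)] gives kl_fun (ab) + a = a kl_fun b + ab ln a + 1. Splitting [ln a] into
    its two parts leaves only nonnegative terms, which can then be integrated separately. *)
Lemma kl_funM a b : (0 <= a)%R -> (0 <= b)%R ->
  (kl_fun (a * b) + (a * b) * Num.max (- ln a) 0 + a =
   a * kl_fun b + (a * b) * Num.max (ln a) 0 + 1)%R.
Proof.
rewrite le_eqVlt => /predU1P[<-|a0]; first by rewrite /kl_fun; lra.
rewrite le_eqVlt => /predU1P[<-|b0]; first by rewrite /kl_fun; lra.
have -> : (Num.max (ln a) 0 = ln a + Num.max (- ln a) 0)%R.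
  by have [|] := leP (ln a) 0%R; have [|] := leP (- ln a)%R 0%R; lra.
by rewrite /kl_fun lnM ?posrE//; ring.
Qed.

(* Young's inequality for the pair of convex conjugates [kl_fun], [exp - 1]. *)
Lemma kl_fun_young p h : (0 <= p)%R -> (0 <= h)%R ->
  logp h * p%:E + 1 <= (kl_fun p)%:E + h%:E + logm h * p%:E.
Proof.
rewrite le_eqVlt => /predU1P[<-|p0].
  by rewrite !mule0 /kl_fun !mul0r subr0 !add0r adde0 lee_fin; lra.
rewrite le_eqVlt => /predU1P[<-|h0].
  by rewrite logm0 gt0_mulye ?lte_fin// addey ?leey.
rewrite logpE// logmE// -!EFinM -!EFinD lee_fin.
have -> : (Num.max (ln h) 0 = ln h + Num.max (- ln h) 0)%R.
  by have [|] := leP (ln h) 0%R; have [|] := leP (- ln h)%R 0%R; lra.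
have := ler_wpM2l (ltW p0) (ln_leB1 (divr_gt0 h0 p0)).
have -> : (p * (h / p - 1) = h - p)%R by field; rewrite gt_eqF.
by rewrite ln_div ?posrE// /kl_fun; lra.
Qed.

(** The equality case [p = h] of [kl_fun_young]. *)
Lemma kl_fun_logpm h : (0 <= h)%R ->
  logp h * h%:E + 1 = logm h * h%:E + (kl_fun h)%:E + h%:E.
Proof.
rewrite le_eqVlt => /predU1P[<-|h0].
  by rewrite !mule0 /kl_fun mul0r subr0 !add0r adde0.
rewrite logpE// logmE// -!EFinM -!EFinD; congr EFin.
have -> : (Num.max (ln h) 0 = ln h + Num.max (- ln h) 0)%R.
  by have [|] := leP (ln h) 0%R; have [|] := leP (- ln h)%R 0%R; lra.
by rewrite /kl_fun; ring.
Qed.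

(** The bound ln h >= 1 - 1/h gives - h ln h <= 1 - h. At [h = 0] the product of [+oo] and 0 is
    0. *)
Lemma logmM_le1 h : (0 <= h)%R -> logm h * h%:E <= 1.
Proof.
rewrite le_eqVlt => /predU1P[<-|h0]; first by rewrite mule0.
rewrite logmE// -EFinM lee_fin; have [_|_] := leP (- ln h)%R 0%R; first by lra.
have := ler_wpM2l (ltW h0) (ln_ge1B h0).
by rewrite mulrBr mulr1 divff ?gt_eqF//; lra.
Qed.

Lemma measurable_kl_fun : measurable_fun [set: R] kl_fun.
Proof.
apply: measurable_funD => //; apply: measurable_funB => //.
exact: measurable_funM.
Qed.

Lemma measurable_lne_EFin : measurable_fun [set: R] (fun t => lne t%:E).
Proof.
apply: measurable_fun_ifT => //; first exact: measurable_fun_ler.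
exact/measurable_EFinP.
Qed.

Lemma measurable_logp : measurable_fun [set: R] logp.
Proof.
exact: (measurable_maxe measurable_lne_EFin (measurable_cst _)).
Qed.

Lemma measurable_logm : measurable_fun [set: R] logm.
Proof.
apply: measurable_maxe => //.
by apply: measurableT_comp => //; exact: measurable_lne_EFin.
Qed.

End kl_fun.

Section measurable_comp_kl_fun.
Context d (T : measurableType d) (R : realType) (u : T -> R).
Hypothesis mu : measurable_fun [set: T] u.

Lemma measurable_kl_fun_comp :
  measurable_fun [set: T] (fun x => (kl_fun (u x))%:E).
Proof.
by apply/measurable_EFinP; apply: measurableT_comp mu; exact: measurable_kl_fun.
Qed.

Lemma measurable_logp_comp : measurable_fun [set: T] (fun x => logp (u x)).
Proof. by apply: measurableT_comp mu; exact: measurable_logp. Qed.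

Lemma measurable_logm_comp : measurable_fun [set: T] (fun x => logm (u x)).
Proof. by apply: measurableT_comp mu; exact: measurable_logm. Qed.

End measurable_comp_kl_fun.

Lemma integral_cst_probability d (T : measurableType d) (R : realType)
    (P : probability T R) (r : \bar R) : \int[P]_x cst r x = r.
Proof.
by rewrite integral_cst// -[RHS]mule1; congr (_ * _); exact: probability_setT.
Qed.

(** * Densities, and the divergence expressed through them *)

Section has_density.
Context d (T : measurableType d) (R : realType).

(** The version [g] is real-valued and nonnegative everywhere, not just almost everywhere, so that
    pointwise facts on [kl_fun] apply without exceptional sets. *)
Definition has_density (P : set T -> \bar R) (Q : {measure set T -> \bar R})
    (g : T -> R) :=
  [/\ measurable_fun [set: T] g, (forall x, (0 <= g x)%R) &
      forall A, measurable A -> P A = \int[Q]_(x in A) (g x)%:E].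

Variables (P Q : probability T R).

Lemma has_density_exists : P `<< Q -> exists g, has_density P Q g.
Proof.
move=> PQ; exists (fine \o Radon_Nikodym_SigmaFinite.f P Q).
have fin := Radon_Nikodym_SigmaFinite.f_fin_num PQ.
split => /=.
- apply/measurable_EFinP; apply: eq_measurable_fun (measurable_int _
    (Radon_Nikodym_SigmaFinite.f_integrable PQ)) => x _ /=.
  by rewrite fineK.
- by move=> x; rewrite fine_ge0// Radon_Nikodym_SigmaFinite.f_ge0.
- move=> A mA; rewrite (Radon_Nikodym_SigmaFinite.f_integral PQ)//.
  by apply: eq_integral => x _; rewrite fineK.
Qed.

Lemma has_density_dominates g : has_density P Q g -> P `<< Q.
Proof.
case=> mg g0 PE; apply/null_content_dominatesP => A mA QA0.
rewrite PE//; apply: null_set_integral => //.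
exact/measurable_funTS/measurable_EFinP.
Qed.

Lemma has_density_integral1 g : has_density P Q g ->
  \int[Q]_x (g x)%:E = 1.
Proof. by case=> mg g0 PE; rewrite -PE// probability_setT. Qed.

(** Having the same integral as the Radon-Nikodym derivative over every measurable set, [g] agrees
    with it [Q]-almost everywhere, so the change of variables carries over. *)
Lemma ge0_integral_density g (k : T -> \bar R) : has_density P Q g ->
  measurable_fun [set: T] k -> (forall x, 0 <= k x) ->
  \int[P]_x k x = \int[Q]_x (k x * (g x)%:E).
Proof.
move=> PQg mk k0; have PQ := has_density_dominates PQg.
rewrite -(Radon_Nikodym_SigmaFinite.change_of_variables PQ)//.
have [mg g0 PE] := PQg.
have mf := measurable_int _ (Radon_Nikodym_SigmaFinite.f_integrable PQ).
have f0 := Radon_Nikodym_SigmaFinite.f_ge0 PQ.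
apply: ge0_ae_eq_integral => //.
- exact: emeasurable_funM.
- by apply: emeasurable_funM => //; exact/measurable_EFinP.
- by move=> x _; rewrite mule_ge0// f0.
- by move=> x _; rewrite mule_ge0// lee_fin.
- apply: ae_eqe_mul2l; apply: integral_ae_eq => //.
  + exact: Radon_Nikodym_SigmaFinite.f_integrable.
  + exact/measurable_EFinP.
  + move=> E _ mE; rewrite -PE//.
    by rewrite -(Radon_Nikodym_SigmaFinite.f_integral PQ).
Qed.

(** Against [Q] the integrand becomes [logm g * g], which is at most 1 pointwise. The resulting
    finiteness is what permits cancelling negative parts. *)
Lemma integral_logm_le1 g : has_density P Q g ->
  \int[P]_x logm (g x) <= 1.
Proof.
move=> PQg; have [mg g0 _] := PQg.
rewrite (ge0_integral_density PQg); last 2 first.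
- exact: measurable_logm_comp.
- by move=> x; exact: logm_ge0.
rewrite -(integral_cst_probability Q 1).
apply: ge0_le_integral => //.
- by move=> x _; rewrite mule_ge0 ?logm_ge0 ?lee_fin.
- apply: emeasurable_funM; last exact/measurable_EFinP.
  exact: measurable_logm_comp.
- by move=> x _; exact: logmM_le1.
Qed.

Lemma integral_logp g : has_density P Q g ->
  \int[P]_x logp (g x) = \int[P]_x logm (g x) + \int[Q]_x (kl_fun (g x))%:E.
Proof.
move=> PQg; have [mg g0 PE] := PQg.
have mlp := measurable_logp_comp mg.
have mlm := measurable_logm_comp mg.
have mkl := measurable_kl_fun_comp mg.
have mgE : measurable_fun [set: T] (fun x => (g x)%:E) by exact/measurable_EFinP.
rewrite !(ge0_integral_density PQg)//;
  [|by move=> x; exact: logm_ge0|by move=> x; exact: logp_ge0].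
(* The added 1 is read as the [Q]-integral of 1 on the left and of [g] on the right; then
   [kl_fun_logpm] applies pointwise. *)
apply: (@addeI_fin _ 1) => //.
have Q1 := integral_cst_probability Q 1.
rewrite -[in RHS](has_density_integral1 PQg) -[in LHS]Q1.
have kl0 x : 0 <= (kl_fun (g x))%:E by rewrite lee_fin kl_fun_ge0.
have lp0 x : 0 <= logp (g x) * (g x)%:E by rewrite mule_ge0 ?logp_ge0 ?lee_fin.
have lm0 x : 0 <= logm (g x) * (g x)%:E by rewrite mule_ge0 ?logm_ge0 ?lee_fin.
have mlpg : measurable_fun [set: T] (fun x => logp (g x) * (g x)%:E).
  exact: emeasurable_funM.
have mlmg : measurable_fun [set: T] (fun x => logm (g x) * (g x)%:E).
  exact: emeasurable_funM.
rewrite -!ge0_integralD//.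
- by apply: eq_integral => x _; exact: kl_fun_logpm.
- by move=> x _; rewrite adde_ge0.
- exact: emeasurable_funD.
- by move=> x _; rewrite lee_fin.
Qed.

Lemma KL_density g : has_density P Q g ->
  KL P Q = \int[Q]_x (kl_fun (g x))%:E.
Proof.
move=> PQg; have [mg g0 PE] := PQg; have PQ := has_density_dominates PQg.
rewrite /KL asboolT//.
set f := 'd (charge_of_finite_measure P) '/d Q.
have fE x : f x = (fine (f x))%:E.
  by rewrite fineK//; exact: Radon_Nikodym_fin_num.
have intf : Q.-integrable [set: T] f by exact: Radon_Nikodym_integrable.
have fg : ae_eq Q [set: T] f (EFin \o g).
  apply: integral_ae_eq => //; first exact/measurable_EFinP.
  by move=> A _ mA; rewrite -Radon_Nikodym_integral// -PE.
transitivity (\int[P]_x lne (g x)%:E).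
  apply: ae_eq_integral => //.
  - rewrite (_ : (fun x => _) = (fun t => lne t%:E) \o (fine \o f)).
      apply: measurableT_comp; first exact: measurable_lne_EFin.
      apply/measurable_EFinP; rewrite (_ : EFin \o _ = f).
        by move/integrableP : intf => [].
      by apply/funext => x; rewrite [RHS]fE.
    by apply/funext => x; congr lne; exact: fE.
  - exact: (measurableT_comp measurable_lne_EFin mg).
  - have := null_dominates_ae_eq measurableT PQ fg.
    by apply: filterS => x /= fgx _; rewrite fgx.
rewrite integralE.
under eq_integral do rewrite funeposE -/(logp _).
under [X in _ - X]eq_integral do rewrite funenegE -/(logm _).
(* The positive part integrates to the negative part plus the target, and the negative part cancels
   because its integral is finite. *)
rewrite (integral_logp PQg) addeAC subee ?add0e//.
rewrite ge0_fin_numE; last by apply: integral_ge0 => x _; exact: logm_ge0.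
exact: le_lt_trans (integral_logm_le1 PQg) (ltry _).
Qed.

Lemma KL_ge0 : P `<< Q -> 0 <= KL P Q.
Proof.
move=> /has_density_exists[g PQg]; rewrite (KL_density PQg).
by apply: integral_ge0 => x _; rewrite lee_fin kl_fun_ge0//; case: PQg.
Qed.

(** Donsker-Varadhan for the test function [ln h], whose exponential has [Q]-mean 1. It is
    [kl_fun_young] at [p = g x], integrated over [Q]; the negative part of [ln h] sits on the right,
    so nothing infinite is subtracted. *)
Lemma integral_logp_le_KL g (h : T -> R) : has_density P Q g ->
  measurable_fun [set: T] h -> (forall x, (0 <= h x)%R) ->
  \int[Q]_x (h x)%:E = 1 ->
  \int[P]_x logp (h x) <= KL P Q + \int[P]_x logm (h x).
Proof.
move=> PQg mh h0 h1; have [mg g0 PE] := PQg.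
have mlp := measurable_logp_comp mh.
have mlm := measurable_logm_comp mh.
have mkl := measurable_kl_fun_comp mg.
have mgE : measurable_fun [set: T] (fun x => (g x)%:E) by exact/measurable_EFinP.
have mhE : measurable_fun [set: T] (fun x => (h x)%:E) by exact/measurable_EFinP.
rewrite (KL_density PQg).
rewrite !(ge0_integral_density PQg)//;
  [|by move=> x; exact: logm_ge0|by move=> x; exact: logp_ge0].
have Q1 := integral_cst_probability Q 1.
rewrite -(@leeD2rE _ 1)// [in leRHS]addeAC -[in leRHS]h1 -[in leLHS]Q1.
have kl0 x : 0 <= (kl_fun (g x))%:E by rewrite lee_fin kl_fun_ge0.
have lp0 x : 0 <= logp (h x) * (g x)%:E by rewrite mule_ge0 ?logp_ge0 ?lee_fin.
have lm0 x : 0 <= logm (h x) * (g x)%:E by rewrite mule_ge0 ?logm_ge0 ?lee_fin.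
have mlpg : measurable_fun [set: T] (fun x => logp (h x) * (g x)%:E).
  exact: emeasurable_funM.
have mlmg : measurable_fun [set: T] (fun x => logm (h x) * (g x)%:E).
  exact: emeasurable_funM.
have hE0 x : 0 <= (h x)%:E by rewrite lee_fin.
rewrite -!ge0_integralD//.
- apply: ge0_le_integral => //.
  + by move=> x _; rewrite adde_ge0.
  + exact: emeasurable_funD.
  + by apply: emeasurable_funD => //; exact: emeasurable_funD.
  + by move=> x _; exact: kl_fun_young.
- by move=> x _; rewrite adde_ge0.
- exact: emeasurable_funD.
Qed.

End has_density.

Lemma has_density_prob d (T : measurableType d) (R : realType)
    (Q : probability T R) (g : T -> R) :
  measurable_fun [set: T] g -> (forall x, (0 <= g x)%R) ->
  \int[Q]_x (g x)%:E = 1 -> exists P : probability T R, has_density P Q g.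
Proof.
move=> mg g0 g1; pose P (A : set T) := \int[Q]_(x in A) (g x)%:E.
have mgE : measurable_fun [set: T] (EFin \o g) by exact/measurable_EFinP.
have P0 : P set0 = 0 by rewrite /P integral_set0.
have Pge0 A : 0 <= P A by apply: integral_ge0 => x _; rewrite lee_fin.
have Psig : semi_sigma_additive P.
  by apply: semi_sigma_additive_nng_induced => // x; rewrite lee_fin.
pose iM := isMeasure.Build _ _ _ P P0 Pge0 Psig.
pose mP : {measure set T -> \bar R} := HB.pack P iM.
pose iP := Measure_isProbability.Build _ _ _ mP g1.
pose pP : probability T R := HB.pack P iM iP.
by exists pP.
Qed.

(** * Disintegration over a product space and the chain rule *)

Section disintegration.
Context d1 d2 (T1 : measurableType d1) (T2 : measurableType d2) (R : realType).
Variables (Q1 : probability T1 R) (Q2 : probability T2 R).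
(** Agreement with the product on measurable sets is all that is asked of [Q], so that the section
    covers the output of a product kernel as well as [Q1 \x Q2] itself. *)
Variable Q : probability (T1 * T2)%type R.
Hypothesis QE : forall A, measurable A -> Q A = (Q1 \x Q2) A.

(** Joint measurability of [h] replaces a kernel structure on [P2]: integrals against [P2 x] are
    integrals against [Q2] weighted by [h (x, y)], hence measurable in [x]. *)
Definition disintegrates (P : probability (T1 * T2)%type R)
    (P1 : probability T1 R) (P2 : T1 -> probability T2 R)
    (g : T1 -> R) (h : T1 * T2 -> R) :=
  [/\ measurable_fun [set: T1 * T2] h, has_density P1 Q1 g,
      forall x, has_density (P2 x) Q2 (fun y => h (x, y)) &
      has_density P Q (fun z => g z.1 * h z)%R].

Lemma ge0_integral_prod (k : T1 * T2 -> \bar R) :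
  measurable_fun [set: T1 * T2] k -> (forall z, 0 <= k z) ->
  \int[Q]_z k z = \int[Q1]_x \int[Q2]_y k (x, y).
Proof.
move=> mk k0; rewrite -(fubini_tonelli1 k mk k0).
by apply: eq_measure_integral => A mA _; exact: QE.
Qed.

Lemma measurable_ge0_integral_snd (k : T1 * T2 -> \bar R) :
  measurable_fun [set: T1 * T2] k -> (forall z, 0 <= k z) ->
  measurable_fun [set: T1] (fun x => \int[Q2]_y k (x, y)).
Proof. by move=> mk k0; exact: measurable_fun_fubini_tonelli_F. Qed.

(** With [f] the joint density, [g] is its marginal in the first coordinate and [h] is the quotient
    of [f] by [g]. *)
Lemma disintegration (P : probability (T1 * T2)%type R) : P `<< Q ->
  exists P1 P2 g h, disintegrates P P1 P2 g h.
Proof.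
move=> /has_density_exists[f Pf]; have [mf f0 PE] := Pf.
have mfE : measurable_fun [set: T1 * T2] (EFin \o f) by exact/measurable_EFinP.
have fE0 z : 0 <= (EFin \o f) z by rewrite lee_fin.
pose F x := \int[Q2]_y (f (x, y))%:E.
have mF : measurable_fun [set: T1] F.
  exact: (measurable_ge0_integral_snd mfE).
have F0 x : 0 <= F x by apply: integral_ge0 => y _; rewrite lee_fin.
have F1 : \int[Q1]_x F x = 1.
  by rewrite -(has_density_integral1 Pf) (ge0_integral_prod mfE).
have Ffin : {ae Q1, forall x, [set: T1] x -> F x \is a fin_num}.
  apply: integrable_ae => //; apply/integrableP; split => //.
  by under eq_integral do rewrite gee0_abs//; rewrite F1 ltry.
pose g := fine \o F.
have mg : measurable_fun [set: T1] g by exact: measurableT_comp.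
have g0 x : (0 <= g x)%R by rewrite fine_ge0.
have g1 : \int[Q1]_x (g x)%:E = 1.
  rewrite -F1; apply: ge0_ae_eq_integral => //.
  - exact/measurable_EFinP.
  - by move=> x _; rewrite lee_fin.
  - by apply: filterS Ffin => x /(_ Logic.I) Fx _; rewrite /g/= fineK.
(* The value 1 makes [h (x, .)] a density even where [g] vanishes. This includes the null set where
   [F] is infinite, since [fine] sends [+oo] to 0. *)
pose h z := if (g z.1 == 0)%R then 1%R else (f z / g z.1)%R.
have mg1 : measurable_fun [set: T1 * T2] (g \o fst).
  exact: measurableT_comp.
have mh : measurable_fun [set: T1 * T2] h.
  apply: measurable_fun_ifT => //; first exact: measurable_fun_eqr.
  apply: measurable_funM => //.
  rewrite (_ : (fun z => _) = (fun t => t `^ (-1))%R \o (g \o fst)).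
    by apply: measurableT_comp mg1; exact: measurable_powR.
  by apply/funext => z /=; rewrite powR_inv1.
have h0 z : (0 <= h z)%R by rewrite /h; case: ifP => // _; rewrite divr_ge0.
have h1 x : \int[Q2]_y (h (x, y))%:E = 1.
  rewrite /h/=; have [gx0|gx0] := eqVneq (g x) 0%R.
    exact: integral_cst_probability.
  under eq_integral do rewrite mulrC EFinM.
  rewrite ge0_integralZl//; last 3 first.
  - exact: measurableT_comp mfE _.
  - by move=> y _; rewrite lee_fin.
  - by rewrite lee_fin invr_ge0.
  have Fx : F x = (g x)%:E.
    rewrite /g/= fineK//; move: gx0; rewrite /g/=.
    by case: (F x) => //=; rewrite eqxx.
  by rewrite -/(F x) Fx -EFinM mulVf.
have [P1 P1g] := has_density_prob mg g0 g1.
have /choice[P2 P2h] x : exists P2x : probability T2 R,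
    has_density P2x Q2 (fun y => h (x, y)).
  by apply: has_density_prob => //; exact: measurableT_comp.
exists P1, P2, g, h; split => //.
have mgh : measurable_fun [set: T1 * T2] (fun z => g z.1 * h z)%R.
  exact: measurable_funM.
have gh0 z : (0 <= g z.1 * h z)%R by rewrite mulr_ge0.
split => // A mA; rewrite PE// !(integral_mkcond A).
have mgA (k : T1 * T2 -> R) : measurable_fun [set: T1 * T2] k ->
    measurable_fun [set: T1 * T2] ((EFin \o k) \_ A).
  move=> mk; apply/(measurable_restrictT _ _).1 => //.
  exact/measurable_funTS/measurable_EFinP.
have kA0 (k : T1 * T2 -> R) : (forall z, 0 <= k z)%R ->
    forall z, 0 <= ((EFin \o k) \_ A) z.
  by move=> k0 z; apply: erestrict_ge0 => {}z _; rewrite lee_fin.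
rewrite (ge0_integral_prod (mgA _ mf) (kA0 _ f0)).
rewrite (ge0_integral_prod (mgA _ mgh) (kA0 _ gh0)).
apply: ge0_ae_eq_integral => //.
- by apply: measurable_ge0_integral_snd; [exact: mgA|exact: kA0].
- by apply: measurable_ge0_integral_snd; [exact: mgA|exact: kA0].
- by move=> x _; apply: integral_ge0 => y _; exact: kA0.
- by move=> x _; apply: integral_ge0 => y _; exact: kA0.
apply: filterS Ffin => x /(_ Logic.I) Fx _.
(* If [g x = 0] then [F x = 0], as [F x] is finite, so the section of [f] at [x] has integral 0,
   matching the right-hand side. *)
have [gx0|gx0] := eqVneq (g x) 0%R.
  rewrite [RHS]integral0_eq; last first.
    by move=> y _; rewrite /patch; case: ifP => //= _; rewrite gx0 mul0r.
  apply/eqP; rewrite eq_le integral_ge0 ?andbT; last by move=> y _; exact: kA0.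
  have <- : F x = 0 by rewrite -(fineK Fx) -[fine _]/(g x) gx0.
  apply: ge0_le_integral => //.
  - by move=> y _; exact: kA0.
  - exact: measurableT_comp (mgA _ mf) _.
  - exact: measurableT_comp mfE _.
  - by move=> y _; rewrite /patch; case: ifP => // _; rewrite lee_fin.
apply: eq_integral => y _; rewrite /patch; case: ifP => //= _.
by rewrite /h/= (negbTE gx0) mulrCA divff// mulr1.
Qed.

Section disintegrates.
Variables (P : probability (T1 * T2)%type R) (P1 : probability T1 R).
Variables (P2 : T1 -> probability T2 R) (g : T1 -> R) (h : T1 * T2 -> R).
Hypothesis dP : disintegrates P P1 P2 g h.

Lemma disintegrates_ge0 z : (0 <= h z)%R.
Proof. by case: dP => _ _ P2h _; case: z => x y; have [_ ->] := P2h x. Qed.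

Let integral_P2 (k : T1 * T2 -> \bar R) x :
  measurable_fun [set: T1 * T2] k -> (forall z, 0 <= k z) ->
  \int[P2 x]_y k (x, y) = \int[Q2]_y (k (x, y) * (h (x, y))%:E).
Proof.
case: dP => _ _ P2h _ mk k0; apply: (ge0_integral_density (P2h x)) => //.
exact: measurableT_comp mk _.
Qed.

Let measurable_kh (k : T1 * T2 -> \bar R) : measurable_fun [set: T1 * T2] k ->
  measurable_fun [set: T1 * T2] (fun z => k z * (h z)%:E).
Proof.
by case: dP => mh _ _ _ mk; apply: emeasurable_funM => //; exact/measurable_EFinP.
Qed.

Let kh_ge0 (k : T1 * T2 -> \bar R) : (forall z, 0 <= k z) ->
  forall z, 0 <= k z * (h z)%:E.
Proof. by move=> k0 z; rewrite mule_ge0// lee_fin disintegrates_ge0. Qed.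

Lemma disintegrates_measurable_integral (k : T1 * T2 -> \bar R) :
  measurable_fun [set: T1 * T2] k -> (forall z, 0 <= k z) ->
  measurable_fun [set: T1] (fun x => \int[P2 x]_y k (x, y)).
Proof.
move=> mk k0; under eq_fun do rewrite integral_P2//.
exact: (measurable_ge0_integral_snd (measurable_kh mk) (kh_ge0 k0)).
Qed.

Lemma disintegrates_measurable_KL :
  measurable_fun [set: T1] (fun x => KL (P2 x) Q2).
Proof.
have [mh _ P2h _] := dP; under eq_fun do rewrite (KL_density (P2h _)).
apply: (measurable_ge0_integral_snd (measurable_kl_fun_comp mh)) => z.
by rewrite lee_fin kl_fun_ge0 ?disintegrates_ge0.
Qed.

Lemma disintegrates_KL_ge0 x : 0 <= KL (P2 x) Q2.
Proof. by have [_ _ P2h _] := dP; apply/KL_ge0/has_density_dominates/P2h. Qed.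

Lemma disintegrates_integral (k : T1 * T2 -> \bar R) :
  measurable_fun [set: T1 * T2] k -> (forall z, 0 <= k z) ->
  \int[P]_z k z = \int[P1]_x \int[P2 x]_y k (x, y).
Proof.
move=> mk k0; have [mh P1g P2h Pgh] := dP; have [mg g0 _] := P1g.
have [mgh gh0 _] := Pgh.
rewrite (ge0_integral_density Pgh)// (ge0_integral_density P1g); last 2 first.
- exact: disintegrates_measurable_integral.
- by move=> x; exact: integral_ge0.
rewrite ge0_integral_prod; last 2 first.
- by apply: emeasurable_funM => //; exact/measurable_EFinP.
- by move=> z; rewrite mule_ge0// lee_fin.
apply: eq_integral => x _; rewrite integral_P2// muleC -ge0_integralZl ?lee_fin//.
- by apply: eq_integral => y _; rewrite /= EFinM muleCA.
- exact: measurableT_comp (measurable_kh mk) _.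
- by move=> y _; exact: kh_ge0.
Qed.

Lemma disintegrates_integral_fst (k : T1 -> \bar R) :
  measurable_fun [set: T1] k -> (forall x, 0 <= k x) ->
  \int[P]_z k z.1 = \int[P1]_x k x.
Proof.
move=> mk k0; rewrite (disintegrates_integral (k := k \o fst)); last 2 first.
- exact: measurableT_comp.
- by move=> z; exact: k0.
apply: eq_integral => x _.
exact: (integral_cst_probability (P2 x) (k x)).
Qed.

End disintegrates.

(** This is [kl_funM] integrated against [Q2], where [b] has integral 1; the terms in [ln a] then
    reduce to [kl_fun a]. *)
Lemma integral_kl_funM (a : R) (P2 : probability T2 R) (b : T2 -> R) :
  (0 <= a)%R -> has_density P2 Q2 b ->
  \int[Q2]_y (kl_fun (a * b y))%:E =
  (kl_fun a)%:E + a%:E * \int[Q2]_y (kl_fun (b y))%:E.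
Proof.
move=> a0 P2b; have [mb b0 _] := P2b; have b1 := has_density_integral1 P2b.
pose p : R := Num.max (ln a) 0%R; pose m : R := Num.max (- ln a)%R 0%R.
have p0 : (0 <= p)%R by rewrite le_max lexx orbT.
have m0 : (0 <= m)%R by rewrite le_max lexx orbT.
have mbE : measurable_fun [set: T2] (EFin \o b) by exact/measurable_EFinP.
have bE0 y : 0 <= (b y)%:E by rewrite lee_fin.
(* The case [b = 1] of [kl_funM], as [kl_fun 1 = 0]. *)
have kla : (kl_fun a + a * m + a = a * p + 1)%R.
  have := kl_funM a0 (@ler01 R); rewrite !mulr1 -/p -/m => ->.
  by rewrite /kl_fun ln1; ring.
apply: (@addeI_fin _ (a * m + a)%:E) => //.
rewrite [RHS]addeAC -EFinD addrA kla.
have klb0 y : 0 <= (kl_fun (b y))%:E by rewrite lee_fin kl_fun_ge0.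
have klab0 y : 0 <= (kl_fun (a * b y))%:E.
  by rewrite lee_fin kl_fun_ge0 ?mulr_ge0.
have mklb := measurable_kl_fun_comp mb.
have mklab : measurable_fun [set: T2] (fun y => (kl_fun (a * b y))%:E).
  by apply: measurable_kl_fun_comp; exact: measurable_funM.
have cbE c : (0 <= c)%R -> \int[Q2]_y (c%:E * (b y)%:E) = c%:E.
  by move=> c0; rewrite ge0_integralZl ?lee_fin// b1 mule1.
have mcb c : measurable_fun [set: T2] (fun y => c%:E * (b y)%:E).
  exact: measurable_funeM.
transitivity (\int[Q2]_y ((kl_fun (a * b y))%:E + (a * m)%:E * (b y)%:E
    + cst a%:E y)).
  have ? y : 0 <= (a * m)%:E * (b y)%:E by rewrite mule_ge0 ?lee_fin ?mulr_ge0.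
  rewrite !ge0_integralD// ?integral_cst_probability ?cbE ?mulr_ge0//.
  - by rewrite EFinD addeA.
  - by move=> y _; rewrite adde_ge0.
  - exact: emeasurable_funD.
transitivity (\int[Q2]_y (a%:E * (kl_fun (b y))%:E + (a * p)%:E * (b y)%:E
    + cst 1 y)).
  apply: eq_integral => y _.
  rewrite -!EFinM -!EFinD; congr EFin.
  by have := kl_funM a0 (b0 y); rewrite -/p -/m; lra.
have ? y : 0 <= (a * p)%:E * (b y)%:E by rewrite mule_ge0 ?lee_fin ?mulr_ge0.
have ? y : 0 <= a%:E * (kl_fun (b y))%:E by rewrite mule_ge0// lee_fin.
have mkl' := measurable_funeM a%:E mklb.
rewrite !ge0_integralD// ?integral_cst_probability ?cbE ?mulr_ge0//
  ?ge0_integralZl ?lee_fin//.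
- by rewrite -addeA addeC EFinD.
- by move=> y _; rewrite adde_ge0.
- exact: emeasurable_funD.
Qed.

(** Integrating [integral_kl_funM] over the first coordinate, the factor [g x] turns the second term
    into an integral against [P1]. *)
Lemma KL_chain P P1 P2 g h : disintegrates P P1 P2 g h ->
  KL P Q = KL P1 Q1 + \int[P1]_x KL (P2 x) Q2.
Proof.
case=> mh P1g P2h Pgh; have [mg g0 _] := P1g.
have h0 z : (0 <= h z)%R by case: z => x y; have [_ ->] := P2h x.
rewrite (KL_density Pgh) (KL_density P1g).
under [X in _ + X]eq_integral do rewrite (KL_density (P2h _)).
have klh0 z : 0 <= (kl_fun (h z))%:E by rewrite lee_fin kl_fun_ge0.
have mklh := measurable_kl_fun_comp mh.
have mJ := measurable_ge0_integral_snd mklh klh0.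
have J0 x : 0 <= \int[Q2]_y (kl_fun (h (x, y)))%:E by exact: integral_ge0.
rewrite (ge0_integral_density P1g)// ge0_integral_prod; last 2 first.
- apply: measurable_kl_fun_comp; apply: measurable_funM => //.
  exact: measurableT_comp.
- by move=> z; rewrite lee_fin kl_fun_ge0 ?mulr_ge0.
rewrite -ge0_integralD//; last 4 first.
- by move=> x _; rewrite lee_fin kl_fun_ge0.
- exact: measurable_kl_fun_comp.
- by move=> x _; rewrite mule_ge0 ?lee_fin.
- by apply: emeasurable_funM => //; exact/measurable_EFinP.
apply: eq_integral => x _ /=.
by rewrite (integral_kl_funM (g0 x) (P2h x)) muleC.
Qed.

End disintegration.

(** * Integration against output distributions and absolute continuity *)

Section output_theory.
Context dX dY (X : measurableType dX) (Y : measurableType dY) (R : realType).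
Implicit Types (P Q : probability X R) (K : R.-pker X ~> Y).

Lemma ge0_integral_output P K (k : Y -> \bar R) :
  measurable_fun [set: Y] k -> (forall y, 0 <= k y) ->
  \int[output P K]_y k y = \int[P]_x \int[K x]_y k y.
Proof.
move=> mk k0.
pose f : {mfun (unit * X)%type >-> X} :=
  HB.pack (snd : unit * X -> X) (isMeasurableFun.Build _ _ _ _ _ measurable_snd).
(* The output is the composition of two kernels, the first being the constant kernel [P] on
   [unit]. *)
have mP : measurable_fun [set: unit] (fun=> P : pprobability X R) by [].
exact: (integral_kcomp (kprobability mP) (pker_comp K f) tt k0 mk).
Qed.

(** A set [A] is null for the output exactly when [K x A = 0] for almost every [x], a property that
    passes from [Q] to [P]. *)
Lemma output_dominates P Q K : P `<< Q -> output P K `<< output Q K.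
Proof.
move=> PQ; apply/null_content_dominatesP => A mA.
have mK := measurable_kernel K A mA.
have absE (mu : probability X R) : output mu K A = \int[mu]_x `|K x A|.
  by apply: eq_integral => x _; rewrite gee0_abs.
move=> Q0; have K0 : ae_eq Q [set: X] (K ^~ A) (cst 0).
  by apply/(ae_eq_integral_abs Q measurableT mK).1; rewrite -absE.
transitivity (\int[P]_x `|K x A|); first exact: absE.
apply/(ae_eq_integral_abs P measurableT mK).2.
exact: null_dominates_ae_eq PQ K0.
Qed.

End output_theory.

(** * Outputs of product kernels and their conditional divergence *)

Section output_prod.
Context dX1 dX2 dY1 dY2 (X1 : measurableType dX1) (X2 : measurableType dX2)
  (Y1 : measurableType dY1) (Y2 : measurableType dY2) (R : realType).
Variables (Q1 : probability X1 R) (Q2 : probability X2 R).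
Variables (K1 : R.-pker X1 ~> Y1) (K2 : R.-pker X2 ~> Y2).

Let QX : probability (X1 * X2)%type R := (Q1 \x Q2)%E.
Let QY1 := output Q1 K1.
Let QY2 := output Q2 K2.

(** A product measure is determined by rectangles, on which the integrand factorizes. *)
Lemma output_pker_prod A : measurable A ->
  output QX (pker_prod K1 K2) A = (QY1 \x QY2) A.
Proof.
move=> mA; apply/esym/product_measure_unique => // A1 A2 mA1 mA2.
transitivity (\int[QX]_z (K1 z.1 A1 * K2 z.2 A2)).
  by apply: eq_integral => z _; exact: product_measure1E.
rewrite (fubini_tonelli1 (fun z => K1 z.1 A1 * K2 z.2 A2)); last 2 first.
- apply: emeasurable_funM.
    exact: (measurableT_comp (measurable_kernel K1 _ mA1) measurable_fst).
  exact: (measurableT_comp (measurable_kernel K2 _ mA2) measurable_snd).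
- by move=> z; rewrite mule_ge0.
have mK1 := measurable_kernel K1 A1 mA1; have mK2 := measurable_kernel K2 A2 mA2.
transitivity (\int[Q1]_x (\int[Q2]_y K2 y A2 * K1 x A1)).
  by apply: eq_integral => x _; rewrite muleC -ge0_integralZl.
rewrite (ge0_integralZl Q1 measurableT mK1)//; last exact: integral_ge0.
exact: muleC.
Qed.

Variables (P : probability (X1 * X2)%type R).
Variables (P1 : probability X1 R) (P2 : X1 -> probability X2 R).
Variables (g : X1 -> R) (h : X1 * X2 -> R).
Hypothesis dP : disintegrates Q1 Q2 QX P P1 P2 g h.

Let PY := output P (pker_prod K1 K2).

(** Given the first input [x], the two outputs are independent, with laws [K1 x] and
    [output (P2 x) K2]. The order of integration in [u] lets Donsker-Varadhan be applied at each
    fixed [y1]. *)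
Lemma ge0_integral_output_pker_prod (k : Y1 * Y2 -> \bar R) :
  measurable_fun [set: Y1 * Y2] k -> (forall y, 0 <= k y) ->
  let u x := \int[K1 x]_y1 \int[output (P2 x) K2]_y2 k (y1, y2) in
  measurable_fun [set: X1] u /\ \int[PY]_y k y = \int[P1]_x u x.
Proof.
move=> mk k0 u.
pose v (z : X1 * X2) := \int[pker_prod K1 K2 z]_y k y.
have v0 z : 0 <= v z by exact: integral_ge0.
have mv : measurable_fun [set: X1 * X2] v.
  apply: measurable_fun_integral_kernel => // U mU; exact: measurable_kernel.
have vE x x' : v (x, x') = \int[K1 x]_y1 \int[K2 x']_y2 k (y1, y2).
  exact: (fubini_tonelli1 k mk k0).
(* Tonelli exchanges [y1] with the second input, which also exhibits [u] as a [P2]-integral of a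
   jointly measurable function. *)
have uE x : u x = \int[P2 x]_x' v (x, x').
  pose w (z : Y1 * X2) := \int[K2 z.2]_y2 k (z.1, y2).
  have w0 z : 0 <= w z by exact: integral_ge0.
  have mw : measurable_fun [set: Y1 * X2] w.
    pose f : {mfun (Y1 * X2)%type >-> X2} :=
      HB.pack (snd : Y1 * X2 -> X2)
        (isMeasurableFun.Build _ _ _ _ _ measurable_snd).
    apply: (measurable_fun_integral_finite_kernel
      (fun z : (Y1 * X2) * Y2 => k (z.1.1, z.2)) (pker_comp K2 f)) => //.
    apply: measurableT_comp mk _; apply: measurable_fun_pair => //=.
    exact: (measurableT_comp measurable_fst measurable_fst).
  transitivity (\int[P2 x]_x' \int[K1 x]_y1 w (y1, x')).
    rewrite -(@fubini_tonelli _ _ _ _ _ (pker_at K1 x) (P2 x) w mw w0).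
    apply: eq_integral => y1 _; apply: ge0_integral_output => //.
    exact: measurableT_comp mk _.
  by apply: eq_integral => x' _; rewrite vE.
split; first by rewrite (funext uE); exact: (disintegrates_measurable_integral dP).
rewrite /PY ge0_integral_output// (disintegrates_integral _ dP mv v0)//.
by apply: eq_integral => x _; rewrite uE.
Qed.

Let QY := output QX (pker_prod K1 K2).

(** Here [u] and [v] are the means, given the first input, of the positive and negative parts of the
    log conditional density of the second output, and [J] is the conditional divergence. *)
Lemma KL_output_pker_prod : exists (u v : X1 -> \bar R) (J : \bar R),
  [/\ [/\ measurable_fun [set: X1] u, measurable_fun [set: X1] v,
          (forall x, 0 <= u x) & (forall x, 0 <= v x)],
      0 <= J,
      forall x, u x <= KL (output (P2 x) K2) QY2 + v x,
      \int[P1]_x v x <= 1 /\ \int[P1]_x u x = \int[P1]_x v x + J &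
      KL PY QY = KL (output P1 K1) QY1 + J].
Proof.
have [mh P1g P2h Pgh] := dP.
have PYQY : PY `<< QY by exact/output_dominates/has_density_dominates/Pgh.
have [PY1 [PY2 [gY [hY dPY]]]] := disintegration output_pker_prod PYQY.
have [mhY PY1g PY2h PYgh] := dPY.
have [mlp mlm] := (measurable_logp_comp mhY, measurable_logm_comp mhY).
have lp0 z : 0 <= logp (hY z) by exact: logp_ge0.
have lm0 z : 0 <= logm (hY z) by exact: logm_ge0.
have [mu uE] := ge0_integral_output_pker_prod mlp lp0.
have [mv vE] := ge0_integral_output_pker_prod mlm lm0.
exists (fun x => \int[K1 x]_y1 \int[output (P2 x) K2]_y2 logp (hY (y1, y2))).
exists (fun x => \int[K1 x]_y1 \int[output (P2 x) K2]_y2 logm (hY (y1, y2))).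
exists (\int[PY1]_y KL (PY2 y) QY2).
split.
- split => //.
  + by move=> x; do 2 apply: integral_ge0 => ? _.
  + by move=> x; do 2 apply: integral_ge0 => ? _.
- by apply: integral_ge0 => y _; exact: (disintegrates_KL_ge0 dPY).
- move=> x.
  have P2Q2 := output_dominates (K := K2) (has_density_dominates (P2h x)).
  have [p P2p] := has_density_exists P2Q2.
  have m1 k : measurable_fun [set: Y1 * Y2] k -> (forall z, 0 <= k z) ->
      measurable_fun [set: Y1] (fun y1 => \int[output (P2 x) K2]_y2 k (y1, y2)).
    exact: measurable_ge0_integral_snd.
  have KL0 := KL_ge0 P2Q2.
  (* The divergence does not depend on [y1], so it is written as an average over [K1 x] to be
     compared under one integral. *)
  have <- : \int[K1 x]_y1 cst (KL (output (P2 x) K2) QY2) y1 =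
      KL (output (P2 x) K2) QY2.
    exact: (integral_cst_probability (pker_at K1 x)).
  rewrite -ge0_integralD//; last 2 first.
  + by move=> y1 _; exact: integral_ge0.
  + exact: (m1 _ mlm lm0).
  apply: ge0_le_integral => //.
  + by move=> y1 _; exact: integral_ge0.
  + exact: (m1 _ mlp lp0).
  + by apply: emeasurable_funD => //; exact: (m1 _ mlm lm0).
  + move=> y1 _; apply: (integral_logp_le_KL P2p) => //.
    * exact: measurableT_comp mhY _.
    * by move=> y2; exact: (disintegrates_ge0 dPY).
    * exact: has_density_integral1 (PY2h y1).
- rewrite -uE -vE !(disintegrates_integral output_pker_prod dPY)//; split.
    rewrite -(integral_cst_probability PY1 1); apply: ge0_le_integral => //.
    + by move=> y _; exact: integral_ge0.
    + exact: (disintegrates_measurable_integral dPY mlm lm0).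
    + by move=> y _; exact: integral_logm_le1 (PY2h y).
  rewrite -ge0_integralD//.
  + apply: eq_integral => y _; rewrite (integral_logp (PY2h y)).
    by rewrite (KL_density (PY2h y)).
  + by move=> y _; exact: integral_ge0.
  + exact: (disintegrates_measurable_integral dPY mlm lm0).
  + by move=> y _; exact: (disintegrates_KL_ge0 dPY).
  + exact: (disintegrates_measurable_KL dPY).
- rewrite (KL_chain output_pker_prod dPY); congr (_ + _).
  (* The marginal [PY1] and [output P1 K1] agree on each measurable [A]: both equal the [PY]-measure
     of [A] times the whole second space. So [gY] is a density for both. *)
  rewrite (KL_density PY1g) (@KL_density _ _ _ (output P1 K1) QY1 gY)//.
  have [mgY gY0 PY1E] := PY1g; split => // A mA; rewrite -PY1E//.
  have mK1 := measurable_kernel K1 A mA.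
  transitivity (\int[P]_z K1 z.1 A).
    by rewrite (disintegrates_integral_fst _ dP mK1).
  transitivity (PY (A `*` setT)).
    apply: eq_integral => z _; apply/esym.
    transitivity (K1 z.1 A * K2 z.2 setT); first exact: product_measure1E.
    by rewrite prob_kernel mule1.
  have -> : PY1 A = \int[PY1]_y (\1_A y)%:E by rewrite integral_indic// setIT.
  rewrite -(disintegrates_integral_fst output_pker_prod dPY); last 2 first.
  - exact/measurable_EFinP.
  - by move=> y; rewrite lee_fin.
  transitivity (\int[PY]_y (\1_(A `*` [set: Y2]) y)%:E).
    by rewrite integral_indic ?setIT//; exact: measurableX.
  by apply: eq_integral => y _; rewrite !indicE in_setX in_setT andbT.
Qed.

End output_prod.

(** * Combining the two inequalities by averaging over the first input *)

Theorem mainTheorem9 (R : realType) (m : nat) (m_gt0 : (0 < m)%N)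
  (c : 'I_m -> R) (c_gt0 : forall j, (0 < c j)%R)
  (dX1 dX2 : measure_display)
  (X1 : measurableType dX1) (X2 : measurableType dX2)
  (dY1 dY2 : 'I_m -> measure_display)
  (Y1 : forall j, measurableType (dY1 j))
  (Y2 : forall j, measurableType (dY2 j))
  (Q1 : probability X1 R) (Q2 : probability X2 R)
  (K1 : forall j, R.-pker X1 ~> Y1 j) (K2 : forall j, R.-pker X2 ~> Y2 j)
  (d1 d2 : R) :
  star Q1 K1 d1 c -> star Q2 K2 d2 c ->
  star (Q1 \x Q2)%E (fun j => pker_prod (K1 j) (K2 j)) (d1 + d2)%R c.
Proof.
move=> star1 star2 P PQ.
have QQ A : measurable A -> (Q1 \x Q2) A = (Q1 \x Q2) A by [].
have [P1 [P2 [g [h dP]]]] := disintegration QQ PQ.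
have [_ P1g P2h _] := dP.
have /choice[u /choice[v /choice[J uvJ]]] j :=
  KL_output_pker_prod (K1 j) (K2 j) dP.
have c0 j : 0 <= (c j)%:E by rewrite lee_fin ltW.
have mu j : measurable_fun [set: X1] (u j) by case: (uvJ j) => -[].
have mv j : measurable_fun [set: X1] (v j) by case: (uvJ j) => -[].
have u0 j x : 0 <= u j x by case: (uvJ j) => -[].
have v0 j x : 0 <= v j x by case: (uvJ j) => -[].
have J0 j : 0 <= J j by case: (uvJ j).
have M0 : 0 <= \int[P1]_x KL (P2 x) Q2.
  by apply: integral_ge0 => x _; exact: (disintegrates_KL_ge0 dP).
have V0 j : 0 <= \int[P1]_x v j x by exact: integral_ge0.
have cM (z : 'I_m -> \bar R) : (forall j, 0 <= z j) -> forall j, 0 <= (c j)%:E * z j.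
  by move=> z0 j; rewrite mule_ge0.
have cs (z : 'I_m -> \bar R) : (forall j, 0 <= z j) ->
    0 <= \sum_(j < m) (c j)%:E * z j.
  by move=> z0; apply: sume_ge0 => j _; exact: cM.
have csD (z w : 'I_m -> \bar R) : (forall j, 0 <= z j) -> (forall j, 0 <= w j) ->
    \sum_(j < m) (c j)%:E * (z j + w j) =
    \sum_(j < m) (c j)%:E * z j + \sum_(j < m) (c j)%:E * w j.
  by move=> z0 w0; rewrite -big_split/=; apply: eq_bigr => j _; rewrite ge0_muleDr.
have csI (w : 'I_m -> X1 -> \bar R) :
    (forall j, measurable_fun [set: X1] (w j)) -> (forall j x, 0 <= w j x) ->
    \int[P1]_x (\sum_(j < m) (c j)%:E * w j x) =
    \sum_(j < m) (c j)%:E * \int[P1]_x w j x.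
  move=> mw w0; rewrite ge0_integral_sum//.
  - by apply: eq_bigr => j _; rewrite ge0_integralZl.
  - by move=> j; exact: measurable_funeM.
  - by move=> j x _; exact: (cM (w ^~ x)).
have mcs (w : 'I_m -> X1 -> \bar R) :
    (forall j, measurable_fun [set: X1] (w j)) ->
    measurable_fun [set: X1] (fun x => \sum_(j < m) (c j)%:E * w j x).
  by move=> mw; apply: emeasurable_sum => j; exact: measurable_funeM.
(* The sign of [d2] is arbitrary, so its two parts go to opposite sides to keep the integrands
   nonnegative. *)
pose d2p : R := Num.max d2 0%R; pose d2m : R := Num.max (- d2)%R 0%R.
have d2p0 : (0 <= d2p)%R by rewrite le_max lexx orbT.
have d2m0 : (0 <= d2m)%R by rewrite le_max lexx orbT.
have d2E : (d2 + d2m = d2p)%R.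
  by rewrite /d2p /d2m; have [|] := leP d2 0%R; have [|] := leP (- d2)%R 0%R; lra.
(* For fixed [x], [star2] at [P2 x] bounds the weighted output divergences, and each of these plus
   [v j x] dominates [u j x]. *)
have uv x : \sum_(j < m) (c j)%:E * u j x + cst d2m%:E x <=
    KL (P2 x) Q2 + \sum_(j < m) (c j)%:E * v j x + cst d2p%:E x.
  have P2Q2 := has_density_dominates (P2h x).
  rewrite /= -d2E EFinD [leRHS]addeA leeD2r// addeAC.
  apply: le_trans (leeD2r _ (star2 _ P2Q2)).
  rewrite -csD//; last by move=> j; exact/KL_ge0/output_dominates.
  by apply: lee_sum => j _; rewrite lee_wpmul2l//; case: (uvJ j).
have mKL := disintegrates_measurable_KL dP.
have KL0 := disintegrates_KL_ge0 dP.
have mKLv : measurable_fun [set: X1]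
    (fun x => KL (P2 x) Q2 + \sum_(j < m) (c j)%:E * v j x).
  by apply: emeasurable_funD => //; exact: mcs.
have intuv : \sum_(j < m) (c j)%:E * \int[P1]_x u j x + d2m%:E <=
    \int[P1]_x KL (P2 x) Q2 + \sum_(j < m) (c j)%:E * \int[P1]_x v j x + d2p%:E.
  rewrite -(integral_cst_probability P1 d2m%:E).
  rewrite -(integral_cst_probability P1 d2p%:E) -!csI//.
  rewrite -!ge0_integralD//; last 5 first.
  - by move=> x _; rewrite adde_ge0//; exact: (cs (v ^~ x)).
  - by move=> x _; exact: (cs (v ^~ x)).
  - exact: mcs.
  - by move=> x _; exact: (cs (u ^~ x)).
  - exact: mcs.
  apply: ge0_le_integral => //.
  - by move=> x _; rewrite adde_ge0//; exact: (cs (u ^~ x)).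
  - by apply: emeasurable_funD => //; exact: mcs.
  - exact: emeasurable_funD.
(* The integral of [u j] is that of [v j] plus [J j]. Each integral of [v j] is at most 1, so their
   weighted sum is finite and cancels, as does [d2m]. *)
have JM : \sum_(j < m) (c j)%:E * J j <= \int[P1]_x KL (P2 x) Q2 + d2%:E.
  have Vfin : \sum_(j < m) (c j)%:E * \int[P1]_x v j x \is a fin_num.
    rewrite ge0_fin_numE ?cs//; apply: lte_sum_pinfty => j _.
    rewrite lte_mul_pinfty//; case: (uvJ j) => _ _ _ [v1 _] _.
    exact: le_lt_trans v1 (ltry _).
  rewrite -(leeD2rE _ _ Vfin) -(@leeD2rE _ d2m%:E)//.
  have UE : \sum_(j < m) (c j)%:E * \int[P1]_x u j x =
      \sum_(j < m) (c j)%:E * \int[P1]_x v j x + \sum_(j < m) (c j)%:E * J j.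
    by rewrite -csD//; apply: eq_bigr => j _; case: (uvJ j) => _ _ _ [_ <-].
  move: intuv; rewrite UE -d2E EFinD [in X in X -> _]addeA.
  by rewrite [X in X + _ <= _]addeC [X in _ <= X + _ -> _]addeAC.
(* The chain rules for inputs and outputs split the goal into [star1] at [P1] and [JM]. *)
rewrite (KL_chain QQ dP) EFinD addeACA.
apply: le_trans (leeD (star1 _ (has_density_dominates P1g)) JM).
rewrite -csD//; last first.
  by move=> j; exact/KL_ge0/output_dominates/has_density_dominates/P1g.
apply: lee_sum => j _.
by case: (uvJ j) => _ _ _ _ <-.
Qed.
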